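(* Let $\mathcal{P}$ be an ADP problem and let $\mathcal{T}_{\mathtt{UT}}(\mathcal{P})=\{\ell\to\{p_1:\flat_{\ell,\mathcal{P}}(r_1),\dots,p_k:\flat_{\ell,\mathcal{P}}(r_k)\}^m\mid \ell\to\{p_1:r_1,\dots,p_k:r_k\}^m\in\mathcal{P}\}$. Then $\mathcal{P}$ is iAST if and only if $\mathcal{T}_{\mathtt{UT}}(\mathcal{P})$ is iAST (i.e., the processor $\mathrm{Proc}_{\mathtt{UT}}(\mathcal{P})=\{\mathcal{T}_{\mathtt{UT}}(\mathcal{P})\}$ is sound and complete).
   Context: Fix a finite signature $\Sigma=\mathcal{D}\uplus\mathcal{C}$ (defined symbols and constructors) and a set of variables $\mathcal{V}$; all left-hand sides of ADPs have root in $\mathcal{D}$. For each $f\in\mathcal{D}$ let $f^\#$ be a fresh symbol of the same arity, $\mathcal{D}^\#=\{f^\#\mid f\in\mathcal{D}\}$, $\Sigma^\#=\Sigma\uplus\mathcal{D}^\#$; elements of $\mathcal{T}(\Sigma^\#,\mathcal{V})$ are annotated terms. $\mathrm{pos}_{\Sigma'}(t)$ is the set of positions of $t$ carrying a symbol of $\Sigma'$. For $\Phi\subseteq\mathrm{pos}_{\mathcal{D}\cup\mathcal{D}^\#}(t)$, $\#_\Phi(t)$ annotates exactly the symbols at positions in $\Phi$ and removes all other annotations; $\flat(t)=\#_\emptyset(t)$; $\#_\varepsilon(t)=\#_{\{\varepsilon\}}(t)$ and $t^\#=\#_\varepsilon(t)$; $\flat_{\uparrow\pi}(t)$ removes all annotations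 strictly above position $\pi$. A finite multi-distribution on $A\neq\emptyset$ is a finite multiset $\mu$ of pairs $(p:a)$, $0<p\le1$, $a\in A$, with probabilities summing to 1. An ADP is $\ell\to\{p_1:r_1,\dots,p_k:r_k\}^m$ with $\ell\in\mathcal{T}(\Sigma,\mathcal{V})\setminus\mathcal{V}$, $m\in\{\mathsf{true},\mathsf{false}\}$, $\{p_1:r_1,\dots,p_k:r_k\}$ a finite multi-distribution on $\mathcal{T}(\Sigma^\#,\mathcal{V})$, $\mathcal{V}(r_j)\subseteq\mathcal{V}(\ell)$. An ADP problem is a finite set $\mathcal{P}$ of ADPs. An annotated term $t$ is a $\mathcal{P}$-normal form if no subterm of $\flat(t)$ is an instance of a left-hand side of $\mathcal{P}$; $\mathtt{ANF}_{\mathcal{P}}$ is the set of annotated terms whose proper subterms are all $\mathcal{P}$-normal forms. $s\hookrightarrow_{\mathcal{P}}\{p_1:t_1,\dots,p_k:t_k\}$ holds if there are an ADP $\ell\to\{p_1:r_1,\dots,p_k:r_k\}^m\in\mathcal{P}$, a substitution $\sigma$ and $\pi\in\mathrm{pos}_{\mathcal{D}\cup\mathcal{D}^\#}(s)$ with $\flat(s|_\pi)=\ell\sigma\in\mathtt{ANF}_{\mathcal{P}}$ such that for all $j$: (pr) $t_j=s[r_j\sigma]_\pi$ if $\pi\in\mathrm{pos}_{\mathcal{D}^\#}(s)$, $m=\mathsf{true}$; (p) $t_j=\flat_{\uparrow\pi}(s[r_j\sigma]_\pi)$ if $\pi\in\mathrm{pos}_{\mathcal{D}^\#}(s)$, $m=\mathsf{false}$;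 (r) $t_j=s[\flat(r_j)\sigma]_\pi$ if $\pi\notin\mathrm{pos}_{\mathcal{D}^\#}(s)$, $m=\mathsf{true}$; (irr) $t_j=\flat_{\uparrow\pi}(s[\flat(r_j)\sigma]_\pi)$ if $\pi\notin\mathrm{pos}_{\mathcal{D}^\#}(s)$, $m=\mathsf{false}$. A $\mathcal{P}$-chain tree (CT) is $\mathfrak{T}=(V,E,L,V_P)$: (1) $(V,E)$ a (possibly infinite) directed tree, $V\neq\emptyset$, every node with finitely many children; (2) $L$ labels each node $v$ with $(p_v,t_v)\in(0,1]\times\mathcal{T}(\Sigma^\#,\mathcal{V})$, $p_v=1$ at the root; (3) $V_P$ is a set of inner nodes, $V_R$ the remaining inner nodes; (4) if $v\in V_P$ has children $w_1,\dots,w_k$ then $t_v\hookrightarrow_{\mathcal{P}}\{\frac{p_{w_1}}{p_v}:t_{w_1},\dots,\frac{p_{w_k}}{p_v}:t_{w_k}\}$ by case (pr) or (p); (5) likewise for $v\in V_R$ by case (r) or (irr); (6) every infinite path contains infinitely many nodes of $V_P$. $|\mathfrak{T}|_{\mathtt{Leaf}}$ is the sum of $p_v$ over all leaves. $\mathcal{P}$ is iAST if $|\mathfrak{T}|_{\mathtt{Leaf}}=1$ for every $\mathcal{P}$-CT. $\mathrm{np}(\mathcal{P})$ is the ordinary TRS $\{\ell\to\flat(r_j)\mid \ell\to\{p_1:r_1,\dots,p_k:r_k\}^{\mathsf{true}}\in\mathcal{P},1\le j\le k\}$; $\overset{i}{\to}_{\mathrm{np}(\mathcal{P})}$ is innermost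 rewriting with it (annotated symbols treated as ordinary symbols). For $\ell_1\in\mathcal{T}(\Sigma,\mathcal{V})$, an annotated term $t$ with $\mathrm{root}(t)\in\mathcal{D}^\#$ is usable w.r.t. $\ell_1$ and $\mathcal{P}$ if there are substitutions $\sigma_1,\sigma_2$ and an ADP $\ell_2\to\mu_2\in\mathcal{P}$ such that some term of $\mu_2$ contains an annotated symbol, with $\#_\varepsilon(t)\sigma_1\overset{i}{\to}{}^*_{\mathrm{np}(\mathcal{P})}\ell_2^\#\sigma_2$ and $\ell_1\sigma_1,\ell_2\sigma_2\in\mathtt{ANF}_{\mathcal{P}}$. $\flat_{\ell,\mathcal{P}}(s)$ is obtained from $s$ by removing the annotations from the roots of all its subterms that are not usable w.r.t. $\ell$ and $\mathcal{P}$, i.e., $\mathrm{pos}_{\mathcal{D}^\#}(\flat_{\ell,\mathcal{P}}(s))=\{\pi\in\mathrm{pos}_{\mathcal{D}^\#}(s)\mid s|_\pi\text{ is usable w.r.t. }\ell\text{ and }\mathcal{P}\}$. *)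

(* Defs.v *)
From HB Require Import structures.
From Stdlib Require Import Relation_Operators.
From mathcomp Require Import all_boot all_order all_algebra.
From mathcomp Require Import all_classical all_reals ereal esum.

Set Implicit Arguments.
Unset Strict Implicit.
Unset Printing Implicit Defensive.

Import Order.TTheory GRing.Theory Num.Theory.

Local Open Scope classical_set_scope.
Local Open Scope ring_scope.

Record signature := Signature {
  defined : finType;
  constructor : finType;
  defined_arity : defined -> nat;
  constructor_arity : constructor -> nat }.

(* The symbols of the annotated signature; [Ann f] is the fresh copy f^# of f. *)
Inductive symbol (S : signature) :=
| Def of defined S
| Con of constructor S
| Ann of defined S.

Arguments Def {S}.
Arguments Con {S}.
Arguments Ann {S}.

Definition arity (S : signature) (f : symbol S) : nat :=
  match f with
  | Def d | Ann d => defined_arity d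
  | Con c => constructor_arity c
  end.

(* Annotated terms.  The terms over the original signature are the annotated
   terms without annotations, see [plain]. *)
Inductive term (S : signature) (V : Type) :=
| Var of V
| App (f : symbol S) of 'I_(arity f) -> term S V.

Arguments Var {S V}.
Arguments App {S V}.

HB.instance Definition _ (S : signature) (V : Type) := gen_eqMixin (term S V).
HB.instance Definition _ (S : signature) (V : Type) :=
  gen_choiceMixin (term S V).

Section Terms.
Variables (S : signature) (V : Type).
Implicit Types (t u : term S V) (p : seq nat) (Phi : set (seq nat)).

Fixpoint subterm_at t p : option (term S V) :=
  if p is i :: q then
    match t with
    | Var _ => None
    | @App _ _ f a =>
        if (insub i : option 'I_(arity f)) is Some j then subterm_at (a j) q
        else None
    end
  else Some t.

(* t[u]_p; only meaningful when p is a position of t. *)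
Fixpoint replace_at t p u : term S V :=
  if p is i :: q then
    match t with
    | Var x => Var x
    | @App _ _ f a =>
        App f (fun j => if val j == i then replace_at (a j) q u else a j)
    end
  else u.

Definition pos_in (F : set (symbol S)) t : set (seq nat) :=
  [set p | exists (f : symbol S) (a : 'I_(arity f) -> term S V),
             subterm_at t p = Some (App f a) /\ F f].

Definition pos_ann t := pos_in (range Ann) t.
Definition pos_def_ann t := pos_in (range Def `|` range Ann) t.

Definition plain : set (term S V) := [set t | pos_ann t = set0].

Definition vars t : set V := [set x | exists p, subterm_at t p = Some (Var x)].

Fixpoint subst (s : V -> term S V) t : term S V :=
  match t with
  | Var x => s x
  | App f a => App f (fun i => subst s (a i))
  end.

Definition plain_subst (s : V -> term S V) := forall x, plain (s x).

Definition set_annotation (b : bool) (f : symbol S) :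
    ('I_(arity f) -> term S V) -> term S V :=
  match f with
  | Def d | Ann d => fun a => if b then App (Ann d) a else App (Def d) a
  | Con c => fun a => App (Con c) a
  end.

(* #_Phi(t): annotates exactly the positions in Phi carrying a symbol of
   D or D^#; the other positions in Phi are ignored. *)
Fixpoint annotate Phi t : term S V :=
  match t with
  | Var x => Var x
  | @App _ _ f a =>
      set_annotation ([::] \in Phi)
        (fun i => annotate [set p | Phi (val i :: p)] (a i))
  end.

Definition flat t := annotate set0 t.

Definition annotate_root t := annotate [set [::]] t.

Definition flat_above p t :=
  annotate (pos_ann t `\` [set q | prefix q p /\ q != p]) t.

End Terms.

Section Rewriting.
Variables (S : signature) (V : Type).
Implicit Types (T : set (term S V * term S V)) (t u : term S V).

Definition trs_nf T t := forall p l r (s : V -> term S V),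
  T (l, r) -> subterm_at t p <> Some (subst s l).

Definition innermost_step T t u :=
  exists l r (s : V -> term S V) p,
    [/\ T (l, r), subterm_at t p = Some (subst s l),
        forall q w, q != [::] -> subterm_at (subst s l) q = Some w ->
          trs_nf T w
      & u = replace_at t p (subst s r)].

Definition innermost_steps T := clos_refl_trans (term S V) (innermost_step T).

End Rewriting.

(* The finite multi-distribution on the right is represented by a list of its
   elements; the order of the list is irrelevant for all notions below. *)
Record adp (R : realType) (S : signature) (V : Type) := ADP {
  lhs : term S V;
  rhs : seq (R * term S V);
  flag : bool }.

(* The four cases of the rewrite relation of ADPs. *)
Variant step_case := case_pr | case_p | case_r | case_irr.

Section ADPs.
Variables (R : realType) (S : signature) (V : Type).
Implicit Types (P : set (adp R S V)) (A : adp R S V) (t u : term S V).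

Definition multi_distribution (mu : seq (R * term S V)) :=
  (forall x, x \in mu -> 0 < x.1 <= 1) /\ \sum_(x <- mu) x.1 = 1.

Definition is_adp A :=
  [/\ plain (lhs A),
      exists d a, lhs A = App (Def d) a,
      multi_distribution (rhs A)
    & forall x, x \in rhs A -> vars x.2 `<=` vars (lhs A)].

Definition adp_problem P := finite_set P /\ P `<=` [set A | is_adp A].

Definition nf P : set (term S V) :=
  [set t | ~ exists p A s, [/\ P A, plain_subst s &
             subterm_at (flat t) p = Some (subst s (lhs A))]].

Definition anf P : set (term S V) :=
  [set t | forall p u, p != [::] -> subterm_at t p = Some u -> nf P u].

Definition step_result (c : step_case) t p (s : V -> term S V) r : term S V :=
  match c with
  | case_pr => replace_at t p (subst s r)
  | case_p => flat_above p (replace_at t p (subst s r))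
  | case_r => replace_at t p (subst s (flat r))
  | case_irr => flat_above p (replace_at t p (subst s (flat r)))
  end.

Definition step_cond (c : step_case) t p (m : bool) : Prop :=
  match c with
  | case_pr => pos_ann t p /\ m = true
  | case_p => pos_ann t p /\ m = false
  | case_r => ~ pos_ann t p /\ m = true
  | case_irr => ~ pos_ann t p /\ m = false
  end.

Definition adp_step P (c : step_case) t (mu : seq (R * term S V)) :=
  exists A (s : V -> term S V) p u,
    [/\ P A /\ plain_subst s,
        pos_def_ann t p /\ subterm_at t p = Some u,
        flat u = subst s (lhs A) /\ anf P (subst s (lhs A)),
        step_cond c t p (flag A)
      & mu = [seq (x.1, step_result c t p s x.2) | x <- rhs A]].

(* The data (V, E, L, V_P) of a chain tree. *)
Record labeled_tree := LabeledTree {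
  node : choiceType;
  edge : node -> node -> Prop;
  root : node;
  prob : node -> R;
  label : node -> term S V;
  pnode : set node }.

Implicit Types (T : labeled_tree).

Definition directed_tree T :=
  [/\ forall v, ~ edge v (root T),
      forall v, v <> root T -> exists! w, edge w v
    & forall v, clos_refl_trans (node T) (@edge T) (root T) v].

Definition children T (v : node T) : set (node T) := [set w | edge v w].
Definition inner T (v : node T) : Prop := children v !=set0.
Definition leaf T (v : node T) : Prop := children v = set0.

(* The children of v are enumerated in the order of the right-hand side. *)
Definition tree_step P c T (v : node T) :=
  exists ws : seq (node T),
    [/\ uniq ws, [set` ws] = children v
      & adp_step P c (label v) [seq (prob w / prob v, label w) | w <- ws]].

Definition chain_tree P T :=
  (directed_tree T /\ forall v : node T, finite_set (children v)) /\
  ((forall v : node T, 0 < prob v <= 1) /\ prob (root T) = 1) /\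
  (forall v : node T, pnode v -> inner v) /\
  (forall v : node T, pnode v ->
     tree_step P case_pr v \/ tree_step P case_p v) /\
  (forall v : node T, inner v -> ~ pnode v ->
     tree_step P case_r v \/ tree_step P case_irr v) /\
  (forall f : nat -> node T, (forall n, edge (f n) (f n.+1)) ->
     forall n, exists2 m, (n <= m)%N & pnode (f m)).

Definition leaf_prob T : \bar R :=
  (\esum_(v in [set v : node T | leaf v]) (prob v)%:E)%E.

Definition iAST P := forall T, chain_tree P T -> leaf_prob T = 1%E.

Definition np P : set (term S V * term S V) :=
  [set lr | exists A x, [/\ P A, flag A, x \in rhs A
                          & lr = (lhs A, flat x.2)]].

Definition usable P (l : term S V) t :=
  (exists d a, t = App (Ann d) a) /\
  exists (s1 s2 : V -> term S V) A,
    [/\ plain_subst s1 /\ plain_subst s2,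
        P A, exists2 x, x \in rhs A & pos_ann x.2 !=set0,
        innermost_steps (np P) (subst s1 (annotate_root t))
          (subst s2 (annotate_root (lhs A)))
      & anf P (subst s1 l) /\ anf P (subst s2 (lhs A))].

Definition flat_usable P (l : term S V) t :=
  annotate [set p | pos_ann t p /\
                    exists2 u, subterm_at t p = Some u & usable P l u] t.

Definition usable_adp P A : adp R S V :=
  ADP (lhs A) [seq (x.1, flat_usable P (lhs A) x.2) | x <- rhs A] (flag A).

Definition usable_terms P : set (adp R S V) := usable_adp P @` P.

End ADPs.

(* Main.v *)
(* Both directions relabel a chain tree, keeping its nodes, edges and
   probabilities: [usable_terms P] has the same left-hand sides as [P], so every
   step can be repeated at the same position, and only the annotations differ.
   From [usable_terms P] to [P] annotations are gained, so P-steps stay P-steps.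
   From [P] to [usable_terms P] annotations are lost, but only "dead" ones, i.e.
   those sitting on a term that is [np P]-reachable from an instance of a
   non-usable subterm: a step below an annotation with flag [false] erases it,
   and a step with flag [true] is an [np P]-step.  A P-step at a dead annotation
   uses an ADP without annotations on the right, hence it strictly shrinks the
   set of annotated positions, whereas no R-step enlarges it.  So a path with
   infinitely many P-steps still has infinitely many after the relabelling. *)

Require Import Defs.
From mathcomp Require Import all_boot all_classical all_reals.
From mathcomp Require Import finmap ssralg.
From Stdlib Require Import Relation_Operators Operators_Properties.

Set Implicit Arguments.
Unset Strict Implicit.
Unset Printing Implicit Defensive.

Local Open Scope classical_set_scope.

(** * Positions, annotations, substitution and replacement in terms *)

Section Positions.
Variables (S : signature) (V : Type).
Implicit Types (t u w : term S V) (p q : seq nat) (Phi Psi : set (seq nat)).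

Lemma subterm_at_nil t : subterm_at t [::] = Some t.
Proof. by case: t. Qed.

Lemma replace_at_nil t w : replace_at t [::] w = w.
Proof. by case: t. Qed.

Lemma subterm_at_App (f : symbol S) (a : 'I_(arity f) -> term S V)
    (j : 'I_(arity f)) q :
  subterm_at (App f a) (val j :: q) = subterm_at (a j) q.
Proof. by rewrite /= valK. Qed.

Lemma subterm_at_cons_some (f : symbol S) (a : 'I_(arity f) -> term S V) i q u :
  subterm_at (App f a) (i :: q) = Some u ->
  exists2 j : 'I_(arity f), i = val j & subterm_at (a j) q = Some u.
Proof. by rewrite /=; case: insubP => // j _ <- h; exists j. Qed.

Lemma subterm_at_cat t p q :
  subterm_at t (p ++ q) = obind (fun u => subterm_at u q) (subterm_at t p).
Proof.
elim: p t => [|i p IH] [x|f a] //=.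
by case: insubP => [j _ _|//]; exact: IH.
Qed.

Lemma eq_annotate Phi Psi t :
  (forall q, Phi q <-> Psi q) -> annotate Phi t = annotate Psi t.
Proof. by move=> h; congr annotate; apply/seteqP; split=> q /h. Qed.

Lemma subterm_at_annotate Phi t p :
  subterm_at (annotate Phi t) p =
  omap (annotate [set q | Phi (p ++ q)]) (subterm_at t p).
Proof.
elim: p t Phi => [|i p IH] t Phi; first by rewrite !subterm_at_nil.
by case: t => [x|[d|c|d] a] //=; try (case: ifP => _ /=);
  case: insubP => [j _ <-|//]; rewrite IH.
Qed.

Lemma annotate_annotate Phi Psi t : annotate Phi (annotate Psi t) = annotate Phi t.
Proof.
elim: t Phi Psi => [//|f a IH] Phi Psi.
have e (b : 'I_(arity f) -> set (seq nat)) (c : 'I_(arity f) -> set (seq nat)) :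
  (fun i => annotate (b i) (annotate (c i) (a i))) = fun i => annotate (b i) (a i).
  by apply: funext => i; rewrite IH.
by case: f a IH e => [d|c|d] a IH e /=; try (case: ([::] \in Psi) => /=);
  rewrite e.
Qed.

Lemma flat_annotate Phi t : flat (annotate Phi t) = flat t.
Proof. exact: annotate_annotate. Qed.

Lemma annotate_flat Phi t : annotate Phi (flat t) = annotate Phi t.
Proof. exact: annotate_annotate. Qed.

Lemma subterm_at_flat t p : subterm_at (flat t) p = omap (@flat S V) (subterm_at t p).
Proof. exact: subterm_at_annotate. Qed.

Lemma pos_annP t q :
  pos_ann t q <-> exists d a, subterm_at t q = Some (App (Ann d) a).
Proof.
split=> [[f [a [e [d _ df]]]]|[d [a e]]]; last by exists (Ann d), a; split=> //; exists d.
(* The type of [a] depends on [f], so [a] and [e] are generalised before [f] becomes [Ann d]. *)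
by case: _ / df a e => a e; exists d, a.
Qed.

Lemma pos_def_annP t q : pos_def_ann t q <->
  exists d, (exists a, subterm_at t q = Some (App (Def d) a)) \/
            (exists a, subterm_at t q = Some (App (Ann d) a)).
Proof.
split=> [[f [a [e [[d _ df]|[d _ df]]]]]|[d [[a e]|[a e]]]].
- by case: _ / df a e => a e; exists d; left; exists a.
- by case: _ / df a e => a e; exists d; right; exists a.
- by exists (Def d), a; split=> //; left; exists d.
- by exists (Ann d), a; split=> //; right; exists d.
Qed.

Lemma pos_ann_def_ann t q : pos_ann t q -> pos_def_ann t q.
Proof. by case/pos_annP=> d [a e]; apply/pos_def_annP; exists d; right; exists a. Qed.

Lemma pos_def_ann_annotate Phi t q : pos_def_ann (annotate Phi t) q <-> pos_def_ann t q.
Proof.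
split=> /pos_def_annP [d h]; apply/pos_def_annP; last first.
  exists d; rewrite subterm_at_annotate.
  by case: h => [[a ->]|[a ->]] /=; case: ifP => _; eauto.
move: h; rewrite subterm_at_annotate; case: subterm_at => [u|]; last by case=> [[]|[]].
by case: u => [x|[e|e|e] a] /= [[b]|[b]] //; do ?case: ifP => //; move=> ? ; exists e; eauto.
Qed.

Lemma pos_def_ann_eq_flat t u q : flat t = flat u -> pos_def_ann t q -> pos_def_ann u q.
Proof.
move=> e; rewrite -(pos_def_ann_annotate set0) => h.
by rewrite -(pos_def_ann_annotate set0) -/(flat u) -e.
Qed.

Lemma pos_ann_annotate Phi t q :
  pos_ann (annotate Phi t) q <-> Phi q /\ pos_def_ann t q.
Proof.
split=> [h|[hPhi /pos_def_annP [d h]]].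
  split; last by move/pos_ann_def_ann: h; rewrite pos_def_ann_annotate.
  move: h => /pos_annP [d [a]]; rewrite subterm_at_annotate.
  case: subterm_at => [[x|[e|e|e] b]|] //=; case: ifP => //;
    by move/set_mem; rewrite /= cats0.
apply/pos_annP; exists d; rewrite subterm_at_annotate.
have E : ([::] \in [set q0 | Phi (q ++ q0)]) = true by apply: mem_set; rewrite /= cats0.
by case: h => [[a ->]|[a ->]] /=; rewrite E; eexists.
Qed.

Lemma pos_ann_flat t q : ~ pos_ann (flat t) q.
Proof. by rewrite pos_ann_annotate => -[]. Qed.

Lemma plainP t : plain t <-> forall q, ~ pos_ann t q.
Proof.
split=> [h q|h]; first by rewrite (h : pos_ann t = set0).
by apply/seteqP; split=> q // /h.
Qed.

Lemma plain_at t p u : plain t -> subterm_at t p = Some u -> plain u.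
Proof.
move=> /plainP h e; apply/plainP => q /pos_annP [d [a ea]].
by apply: (h (p ++ q)); apply/pos_annP; exists d, a; rewrite subterm_at_cat e.
Qed.

Lemma flat_plain t : plain t -> flat t = t.
Proof.
elim: t => [//|f a IH] h.
have e : (fun i => annotate [set p | set0 (val i :: p)] (a i)) = a.
  apply: funext => i; rewrite -[RHS]IH; last first.
    by apply: (@plain_at _ [:: val i] _ h); rewrite subterm_at_App ?subterm_at_nil.
  exact: eq_annotate.
case: f a IH h e => [d|c|d] a IH h e; rewrite /flat /= ?in_set0 ?e //.
by case: ((plainP _).1 h [::]); apply/pos_annP; exists d, a.
Qed.

Lemma plain_flat t : plain (flat t).
Proof. by apply/plainP => q; exact: pos_ann_flat. Qed.

Lemma subterm_at_eq_flat t u p w : flat t = flat u -> subterm_at t p = Some w ->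
  exists2 w', subterm_at u p = Some w' & flat w = flat w'.
Proof.
move=> e h; move: (congr1 (fun x => subterm_at x p) e); rewrite !subterm_at_flat h /=.
by case: subterm_at => // w' [->]; exists w'.
Qed.

Lemma flat_subst (s : V -> term S V) t :
  flat (subst s t) = subst (@flat S V \o s) (flat t).
Proof.
elim: t => [//|f a IH].
have e : (fun i => annotate [set p | set0 (val i :: p)] (subst s (a i))) =
  fun i => subst (@flat S V \o s) (annotate [set p | set0 (val i :: p)] (a i)).
  apply: funext => i; transitivity (flat (subst s (a i))); first exact: eq_annotate.
  by rewrite IH; congr subst; exact: eq_annotate.
by case: f a IH e => [d|c|d] a IH e; rewrite /flat /= ?in_set0 ?e.
Qed.

Lemma flat_plain_subst (s : V -> term S V) t : plain_subst s ->
  flat (subst s t) = subst s (flat t).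
Proof.
by move=> h; rewrite flat_subst; congr subst; apply: funext => x /=; exact: flat_plain.
Qed.

(** The root of [t] has to be a symbol: for a variable [x], the left side would annotate the root of
    [s x] and the right side would not. *)
Lemma annotate_root_subst (s : V -> term S V) t : plain_subst s ->
  (exists f a, t = App f a) -> annotate_root (subst s t) = subst s (annotate_root t).
Proof.
move=> hs [f [a ->]].
have e : (fun i => annotate [set p | [set [::]] (val i :: p)] (subst s (a i))) =
  fun i => subst s (annotate [set p | [set [::]] (val i :: p)] (a i)).
  have e0 u (i : 'I_(arity f)) : annotate [set p | [set [::]] (val i :: p)] u = flat u.
    exact: eq_annotate.
  by apply: funext => i; rewrite !e0 flat_plain_subst.
by case: f a e => [d|c|d] a e; rewrite /annotate_root /=;
  try (case: ifP => _); rewrite /= e.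
Qed.

Lemma subterm_at_subst (s : V -> term S V) t p u :
  subterm_at t p = Some u -> subterm_at (subst s t) p = Some (subst s u).
Proof.
elim: p t => [|i p IH] t; first by rewrite !subterm_at_nil; case=> ->.
by case: t => [//|f a] /subterm_at_cons_some [j -> /IH]; rewrite /= valK.
Qed.

Lemma pos_ann_subst (s : V -> term S V) t q :
  plain_subst s -> pos_ann (subst s t) q <-> pos_ann t q.
Proof.
move=> hs; split; last first.
  by case/pos_annP => d [a /(subterm_at_subst s) h]; apply/pos_annP; exists d; eexists; exact: h.
elim: q t => [|i q IH] [x|f a]; try by move=> h; case: ((plainP _).1 (hs x) _ h).
  case/pos_annP => d [b [/= e _]]; apply/pos_annP; exists d.
  by case: _ / e a => a; exists a.
case/pos_annP => d [b] /subterm_at_cons_some [j -> e].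
have /IH : pos_ann (subst s (a j)) q by apply/pos_annP; exists d, b.
by case/pos_annP => d' [b' e']; apply/pos_annP; exists d', b'; rewrite subterm_at_App ?subterm_at_nil.
Qed.

Lemma subterm_at_replace_cat t p q u w : subterm_at t p = Some u ->
  subterm_at (replace_at t p w) (p ++ q) = subterm_at w q.
Proof.
elim: p t => [|i p IH] t; first by rewrite replace_at_nil.
case: t => [//|f a] /subterm_at_cons_some [j -> /IH].
by rewrite [_ ++ _]/= [replace_at _ _ _]/= subterm_at_App eqxx.
Qed.

Lemma subterm_at_replace_above t p q w :
  subterm_at (replace_at t (q ++ p) w) q =
  omap (fun u => replace_at u p w) (subterm_at t q).
Proof.
elim: q t => [|i q IH] t; first by rewrite !subterm_at_nil.
by case: t => [//|f a] /=; case: insubP => [j _ <-|//]; rewrite eqxx IH.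
Qed.

Lemma subterm_at_replace_parallel t p q w : ~~ prefix p q -> ~~ prefix q p ->
  subterm_at (replace_at t p w) q = subterm_at t q.
Proof.
elim: p q t => [|i p IH] q t; first by rewrite prefix0s.
case: q => [|j q]; first by rewrite prefix0s.
case: t => [//|f a] h1 h2 /=.
case: insubP => [k _ kj|//]; move: h1 h2; rewrite !prefix_cons -kj eq_sym.
by case: eqP => //= _; exact: IH.
Qed.

Lemma annotate_replace Phi t p w : annotate Phi (replace_at t p w) =
  replace_at (annotate Phi t) p (annotate [set q | Phi (p ++ q)] w).
Proof.
elim: p t Phi => [|i p IH] t Phi; first by rewrite !replace_at_nil.
case: t => [//|f a].
have e : (fun j => annotate [set q | Phi (val j :: q)] (if val j == i then replace_at (a j) p w else a j)) =
  fun j => if val j == i then replace_at (annotate [set q | Phi (val j :: q)] (a j)) p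
    (annotate [set q | Phi (i :: p ++ q)] w) else annotate [set q | Phi (val j :: q)] (a j).
  by apply: funext => j; case: eqP => // <-; rewrite IH.
by case: f a e => [d|c|d] a e /=; try (case: ifP => _); rewrite e.
Qed.

Lemma flat_replace t p w : flat (replace_at t p w) = replace_at (flat t) p (flat w).
Proof. by rewrite /flat annotate_replace; congr replace_at; exact: eq_annotate. Qed.

(** Strictly above [p] a replacement keeps the symbol, and at parallel positions the whole subterm;
    from [p] downwards [w] takes over. *)
Lemma pos_ann_replace t p q u w : subterm_at t p = Some u ->
  pos_ann (replace_at t p w) q <->
  (exists2 q', q = p ++ q' & pos_ann w q') \/ ~~ prefix p q /\ pos_ann t q.
Proof.
move=> tp; case: (boolP (prefix p q)) => [/prefixP [q' ->]|npq].
  rewrite /pos_ann /pos_in /= (subterm_at_replace_cat _ _ tp); split=> [h|].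
    by left; exists q'.
  by case=> [[q0 /eqP]|[]//]; rewrite eqseq_cat // eqxx => /eqP <-.
have -> : pos_ann (replace_at t p w) q <-> pos_ann t q.
  case: (boolP (prefix q p)) => [/prefixP [p' pE]|nqp]; last first.
    by rewrite /pos_ann /pos_in /= subterm_at_replace_parallel.
  rewrite !pos_annP pE subterm_at_replace_above.
  case: p' pE => [pE|i p' _]; first by rewrite pE cats0 prefix_refl in npq.
  case: subterm_at => [[x|f a]|] /=; split=> -[d [b]] // [] e _;
    by exists d; move: a; rewrite e => a; eexists.
split=> [h|[[q' qE]|[]//]]; first by right.
by rewrite qE prefix_prefix in npq.
Qed.

Lemma pos_ann_flat_above t p q :
  pos_ann (flat_above p t) q <-> pos_ann t q /\ (prefix q p -> q = p).
Proof.
rewrite pos_ann_annotate; split=> [[[h1 h2] _]|[h1 h2]].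
  by split=> // h; apply: contrapT => /eqP e; apply: h2.
by split; [split=> // -[/h2 -> /eqP]|exact: pos_ann_def_ann].
Qed.

(** Allows annotations to be counted through [fset_set]. Arities are finite, so induction on the
    term yields a finite union. *)
Lemma finite_pos_ann t : finite_set (pos_ann t).
Proof.
elim: t => [x|f a IH].
  by apply: (@sub_finite_set _ _ set0) => // -[|i q] /pos_annP [d [b]].
apply: (@sub_finite_set _ _ ([set [::]] `|`
  \bigcup_(j in [set: 'I_(arity f)]) (cons (val j) @` pos_ann (a j)))).
  move=> [|i q]; first by left.
  move=> /pos_annP [d [b /subterm_at_cons_some [j -> e]]]; right.
  by exists j => //; exists q => //; apply/pos_annP; exists d, b.
rewrite finite_setU; split; first exact: finite_set1.
by apply: bigcup_finite => [|j _]; [exact: finite_finset|exact: finite_image].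
Qed.

End Positions.

(** * Rewrite steps of ADPs and simulations between chain trees *)

Section Steps.
Variables (R : realType) (S : signature) (V : Type).
Implicit Types (P Q : set (adp R S V)) (A : adp R S V) (t u : term S V).

(** Here [b] says whether the redex position is annotated and [m] is the flag; two booleans let one
    formula cover all four cases. *)
Definition step_case_of (b m : bool) : step_case :=
  if b then (if m then case_pr else case_p)
  else (if m then case_r else case_irr).

Definition is_pcase (c : step_case) : bool :=
  if c is (case_pr | case_p) then true else false.

Lemma is_pcase_of b m : is_pcase (step_case_of b m) = b.
Proof. by case: b m => [] []. Qed.

Lemma step_condP c t p m :
  step_cond c t p m <-> c = step_case_of `[< pos_ann t p >] m.
Proof.
by split; case: asboolP => h; case: c; case: m => //= -[].
Qed.

(** The four cases differ only in annotations, so a step and its simulation produce the same flat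
    terms. *)
Lemma flat_step_result c t p s (r : term S V) : plain_subst s ->
  flat (step_result c t p s r) = replace_at (flat t) p (subst s (flat r)).
Proof.
by move=> hs; case: c; rewrite /= /flat_above ?flat_annotate flat_replace
  flat_plain_subst // flat_annotate.
Qed.

(** As [s] is plain, annotations at or below [p] come only from [r], and only if [b]; those strictly
    above [p] survive only if [m]; parallel ones always survive. *)
Lemma pos_ann_step_result b m t p u s (r : term S V) q : plain_subst s ->
  subterm_at t p = Some u ->
  pos_ann (step_result (step_case_of b m) t p s r) q <->
  (exists q', [/\ b, q = p ++ q' & pos_ann r q']) \/
  [/\ ~~ prefix p q, pos_ann t q & prefix q p -> m].
Proof.
move=> hs tp.
have prE (w : term S V) : pos_ann (replace_at t p w) q <->
    (exists2 q', q = p ++ q' & pos_ann w q') \/ ~~ prefix p q /\ pos_ann t q.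
  exact: pos_ann_replace tp.
have E (w : term S V) : (if m then pos_ann (replace_at t p w) q
            else pos_ann (flat_above p (replace_at t p w)) q) <->
    (exists2 q', q = p ++ q' & pos_ann w q') \/
    [/\ ~~ prefix p q, pos_ann t q & prefix q p -> m].
  case: m; rewrite ?pos_ann_flat_above prE.
    by split=> -[h|[h1 h2]]; by [left|right].
  split=> [[[h|[h1 h2]] h3]|[[q' e h]|[h1 h2 h3]]].
  - by left.
  - by right; split=> // /h3 e; rewrite e prefix_refl in h1.
  - split; first by left; exists q'.
    (* If [p ++ q'] is a prefix of [p], then [q'] is empty. *)
    rewrite e => /prefixP [q0]; rewrite -catA -{1}(cats0 p) => /eqP.
    by rewrite eqseq_cat // eqxx /=; case: q' {e h} => // _; rewrite cats0.
  - by split; [right|move=> /h3].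
have -> : pos_ann (step_result (step_case_of b m) t p s r) q =
    if m then pos_ann (replace_at t p (subst s (if b then r else flat r))) q
    else pos_ann (flat_above p (replace_at t p (subst s (if b then r else flat r)))) q.
  by case: b m {E} => [] [].
rewrite E; split=> -[h|h]; try by right.
  case: h => q' e; rewrite pos_ann_subst //; case: b => h.
    by left; exists q'.
  by case: (pos_ann_flat h).
by case: h => q' [hb e h]; left; exists q' => //; rewrite pos_ann_subst // hb.
Qed.

Lemma adp_stepP P c t mu : adp_step P c t mu <->
  exists A s p u,
    [/\ P A /\ plain_subst s,
        pos_def_ann t p /\ subterm_at t p = Some u,
        flat u = subst s (lhs A) /\ anf P (subst s (lhs A)),
        c = step_case_of `[< pos_ann t p >] (flag A)
      & mu = [seq (x.1, step_result c t p s x.2) | x <- rhs A]].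
Proof.
by split=> -[A [s [p [u [h1 h2 h3 h4 h5]]]]]; exists A, s, p, u;
  split=> //; apply/step_condP.
Qed.

(** Normal forms depend on left-hand sides only, and [usable_adp] keeps those. *)
Lemma anf_usable_terms P t : anf (usable_terms P) t <-> anf P t.
Proof.
have nfE u : nf (usable_terms P) u <-> nf P u.
  split=> h [p [A [s]]].
    by case=> hA hs e; apply: h; exists p, (usable_adp P A), s; split=> //; exists A.
  by case=> -[B hB <-] hs e; apply: h; exists p, B, s.
by split=> h p u hp e; apply/nfE; exact: h hp e.
Qed.

Lemma pos_ann_flat_usable P l t q : pos_ann (flat_usable P l t) q <->
  pos_ann t q /\ exists2 u, subterm_at t q = Some u & usable P l u.
Proof.
rewrite pos_ann_annotate; split=> [[]//|h]; split=> //.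
by apply: pos_ann_def_ann; case: h.
Qed.

Lemma flat_flat_usable P l t : flat (flat_usable P l t) = flat t.
Proof. exact: flat_annotate. Qed.

(* The last clause is what keeps condition (6) of chain trees: a path that has
   only finitely many P-steps in the simulation would make [meas] decrease
   infinitely often. *)
Definition simulates Q (I : term S V -> term S V -> Prop)
    (meas : term S V -> nat) c t (mu : seq (R * term S V)) t' :=
  exists c' mu', [/\ adp_step Q c' t' mu', map fst mu' = map fst mu,
    forall d i, (i < size mu)%N -> I (nth d mu i).2 (nth d mu' i).2
    & is_pcase c' \/ forall x, x \in mu ->
        (meas x.2 <= meas t)%N /\ (is_pcase c -> (meas x.2 < meas t)%N)].

(** In both directions the two distributions are images of one list [X] with the same weights, which
    settles the clauses on weights and indices. *)
Lemma simulates_map Q I meas c c' t t' (X : seq (R * term S V)) f g :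
  adp_step Q c' t' [seq (x.1, g x) | x <- X] ->
  (forall x, x \in X -> I (f x) (g x)) ->
  is_pcase c' \/ (forall x, x \in X ->
    (meas (f x) <= meas t)%N /\ (is_pcase c -> (meas (f x) < meas t)%N)) ->
  simulates Q I meas c t [seq (x.1, f x) | x <- X] t'.
Proof.
move=> st hI hm; exists c', [seq (x.1, g x) | x <- X]; split=> //.
- by rewrite -!map_comp.
- move=> d i; rewrite size_map => iX.
  by rewrite !(nth_map d) //=; apply: hI; exact: mem_nth.
- case: hm => [|hm]; first by left.
  by right=> _ /mapP [x xX ->]; exact: hm.
Qed.

(** * Induction and recursion along a directed tree *)

Section Tree.
Variable T : labeled_tree R S V.
Hypothesis treeT : directed_tree T.

Lemma tree_ind (K : node T -> Prop) :
  K (Defs.root T) -> (forall v w, K v -> edge v w -> K w) -> forall v, K v.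
Proof.
case: treeT => _ _ conn h0 hS v.
by elim: (clos_rt_rtn1 _ _ _ _ (conn v)) => // w z vw _ hw; exact: hS vw.
Qed.

Lemma edge_inj v v' (w : node T) : edge v w -> edge v' w -> v = v'.
Proof.
case: treeT => noroot uniqp _ e e'.
have [|x [_ hx]] := uniqp w; first by move=> r; apply: (noroot v); rewrite -r.
by rewrite -(hx _ e) (hx _ e').
Qed.

(** Edges are a mere relation, so the function is chosen from its graph [G n v x], with [n] the
    depth of [v]. Unique parents and a parentless root make the graph functional. *)
Lemma tree_rec (X : Type) (F : node T -> X -> node T -> X) (x0 : X) :
  exists L : node T -> X,
    L (Defs.root T) = x0 /\ forall v w, edge v w -> L w = F v (L v) w.
Proof.
pose G := fix G n v x := match n with
  | 0 => v = Defs.root T /\ x = x0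
  | n.+1 => exists (u : node T) y, [/\ edge u v, G n u y & x = F u y v] end.
have noroot v : ~ edge v (Defs.root T) by case: treeT.
have Guniq n m v x y : G n v x -> G m v y -> x = y.
  elim: n m v x y => [|n IH] [|m] v x y /=.
  - by move=> [_ ->] [_ ->].
  - by move=> [-> _] [u [z [/noroot]]].
  - by move=> [u [z [e _ _]]] [vr _]; case: (noroot u); rewrite -vr.
  - move=> [u [z [e Gz ->]]] [u' [z' [e' Gz' ->]]].
    by have uu := edge_inj e e'; subst u'; rewrite (IH _ _ _ _ Gz Gz').
have Gex v : exists x n, G n v x.
  elim/tree_ind: v => [|v w [x [n Gx]] e]; first by exists x0, 0%N.
  by exists (F v x w), n.+1, v, x.
have [L GL] := choice Gex; exists L; split.
  by have [n h] := GL (Defs.root T); apply: (Guniq n 0%N) h _; split.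
move=> v w e; have [n h] := GL w; have [m k] := GL v.
by apply: (Guniq n m.+1) h _; exists v, (L v).
Qed.

End Tree.

(** A chain tree of [P] is relabelled from the root downwards into one of [Q]. The root keeps its
    label, which reflexivity of [I] permits, and [I] then propagates along edges. *)
Lemma iAST_simulation P Q I meas : (forall t, I t t) ->
  (forall c t mu t', I t t' -> adp_step P c t mu -> simulates Q I meas c t mu t') ->
  iAST Q -> iAST P.
Proof.
move=> Irefl sim hQ T [[treeT fin] [probT [pin [pstep [rstep inf]]]]].
have stepT (v : node T) : inner v -> exists c ws,
    [/\ uniq ws, [set` ws] = children v,
        adp_step P c (label v) [seq (prob w / prob v, label w)%R | w <- ws]
      & pnode v -> is_pcase c].
  move=> iv; have [pv|npv] := pselect (pnode v).
    by case: (pstep v pv) => -[ws [h1 h2 h3]]; [exists case_pr|exists case_p]; exists ws.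
  by case: (rstep v iv npv) => -[ws [h1 h2 h3]]; [exists case_r|exists case_irr]; exists ws.
(* The guards [inner v] and [I (label v) t'] make such an [f] exist for every pair, so that choice
   applies; [IL] discharges the second guard later. *)
pose good v t' (f : node T -> term S V) := inner v -> I (label v) t' ->
  (forall w, edge v w -> I (label w) (f w)) /\
  exists c' ws, [/\ uniq ws, [set` ws] = children v,
    adp_step Q c' t' [seq (prob w / prob v, f w)%R | w <- ws]
  & is_pcase c' \/ forall w, edge v w -> (meas (label w) <= meas (label v))%N /\
      (pnode v -> (meas (label w) < meas (label v))%N)].
have Fex (vt : node T * term S V) : exists f, good vt.1 vt.2 f.
  case: vt => v t' /=.
  have [iv|niv] := pselect (inner v); last by exists (fun=> t').
  have [It|nIt] := pselect (I (label v) t'); last by exists (fun=> t').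
  have [c [ws [uws wsE st pc]]] := stepT v iv.
  have [c' [mu' [st' fstE Imu hc]]] := sim _ _ _ _ It st.
  have szE : size mu' = size ws by move/(congr1 size): fstE; rewrite !size_map.
  pose d := (0%R : R, t').
  have inws w : (w \in ws) <-> edge v w.
    by rewrite -[edge v w]/(children v w) -wsE.
  (* Each child receives the entry of [mu'] at its own index in [ws]; [uniq ws] makes this a
     matching, and [d] is a dummy default. *)
  exists (fun w => (nth d mu' (index w ws)).2) => _ _; split.
    move=> w /inws win; have := Imu d (index w ws).
    rewrite size_map index_mem => /(_ win).
    by rewrite (nth_map w) ?index_mem // nth_index.
  exists c', ws; split=> //.
    suff -> : [seq (prob w / prob v, (nth d mu' (index w ws)).2)%R | w <- ws] = mu' by [].
    apply: (@eq_from_nth _ d) => [|i]; rewrite size_map // => iws.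
    have w0 : node T := v.
    rewrite (nth_map w0) // index_uniq //.
    have := congr1 (fun s => nth 0%R s i) fstE.
    rewrite (nth_map d) ?szE // => h; rewrite [RHS]surjective_pairing h; congr pair.
    by rewrite (nth_map d) ?size_map // (nth_map w0).
  case: hc => [|hc]; [by left|right=> w /inws win].
  have /hc [h1 h2] : (prob w / prob v, label w)%R \in
      [seq (prob w / prob v, label w)%R | w <- ws].
    by apply/mapP; exists w.
  by split=> // /pc.
have [F goodF] := choice Fex.
have [L [L0 LS]] := tree_rec treeT (fun v t' => F (v, t')) (label (Defs.root T)).
have IL v : I (label v) (L v).
  elim/(tree_ind treeT): v => [|v w Iv vw]; first by rewrite L0.
  by rewrite (LS _ _ vw); apply: (goodF (v, L v) _ Iv).1 => //; exists w.
(* [tree_step] ignores the P-nodes, so [T0], with none, suffices to state it before they are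
   chosen. *)
pose T0 := LabeledTree (@edge _ _ _ T) (Defs.root T) (@prob _ _ _ T) L set0.
(* A step may be both a P-step and an R-step, so every node that admits a P-step
   is made a P-node. *)
pose pn : set (node T) := [set v | inner v /\
  (@tree_step R S V Q case_pr T0 v \/ @tree_step R S V Q case_p T0 v)].
pose T' := LabeledTree (@edge _ _ _ T) (Defs.root T) (@prob _ _ _ T) L pn.
have stepT' (v : node T) : inner v -> exists c', @tree_step R S V Q c' T0 v /\
    (is_pcase c' \/ forall w, edge v w -> (meas (label w) <= meas (label v))%N /\
      (pnode v -> (meas (label w) < meas (label v))%N)).
  move=> iv; have [_ [c' [ws [uws wsE st h]]]] := goodF (v, L v) iv (IL v).
  exists c'; split; last exact: h.
  exists ws; split=> //=.
  suff -> : [seq (prob w / prob v, L w)%R | w <- ws] =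
            [seq (prob w / prob v, F (v, L v) w)%R | w <- ws] by [].
  apply/eq_in_map => w win; congr pair; apply: LS.
  by rewrite -[edge v w]/(children v w) -wsE.
have pcase_pn (v : node T) c' : inner v -> @tree_step R S V Q c' T0 v -> is_pcase c' -> pn v.
  by move=> iv; case: c' => // st _; split=> //; [left|right].
(* [leaf_prob] reads only edges and probabilities, so the claims for [T] and [T'] are
   convertible. *)
apply: (hQ T'); split; first by [].
split=> //; split; first by move=> v [].
split; first by move=> v [].
split.
  move=> v iv npv; have [c' [st _]] := stepT' v iv.
  have : ~ is_pcase c' by move/(pcase_pn _ _ iv st)/npv.
  by case: c' st => // st _; [left|right].
(* If the path had no P-node of [T'] from [n] on, [meas] would never increase there and would drop
   at each of the infinitely many P-nodes of [T]. *)
rewrite /T' /= => f fe n; apply: contrapT => noP.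
have npf m : (n <= m)%N -> ~ pn (f m) by move=> nm pm; apply: noP; exists m.
have dec m : (n <= m)%N -> (meas (label (f m.+1)) <= meas (label (f m)))%N /\
    (pnode (f m) -> (meas (label (f m.+1)) < meas (label (f m)))%N).
  move=> nm; have im : inner (f m) by exists (f m.+1); exact: fe.
  have [c' [st [/(pcase_pn _ _ im st)/(npf _ nm)//|h]]] := stepT' _ im.
  exact: h (fe m).
have mono m k : (n <= m)%N -> (meas (label (f (m + k))) <= meas (label (f m)))%N.
  move=> nm; elim: k => [|k IH]; first by rewrite addn0.
  rewrite addnS; apply: leq_trans IH.
  by case: (dec (m + k)%N) => //; exact: leq_trans (leq_addr _ _).
(* Induction on a bound [N] of the measure: the next P-node [k] of [T] still has measure at most
   [N], and its successor has less, which is absurd for [N = 0]. *)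
have desc N : forall m, (n <= m)%N -> (meas (label (f m)) <= N)%N -> False.
  elim: N => [|N IH] m nm le; have [k mk pk] := inf f fe m;
    have nk := leq_trans nm mk; have /(_ pk) lt := (dec k nk).2;
    have := leq_trans (mono m (k - m)%N nm) le; rewrite subnKC // => le'.
    by have := leq_trans lt le'.
  apply: (IH k.+1); first exact: leqW.
  by rewrite -ltnS; exact: leq_trans lt le'.
exact: (desc _ n (leqnn n) (leqnn _)).
Qed.

End Steps.

(** * Completeness and soundness of the usable terms processor *)

Section UsableTerms.
Variables (R : realType) (S : signature) (V : Type) (P : set (adp R S V)).
Hypothesis hP : adp_problem P.
Implicit Types (t u w r : term S V).

(** The simulating term has at least the same annotations, so no P-step is lost and a constant
    measure is enough. *)
Lemma usable_terms_complete : iAST P -> iAST (usable_terms P).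
Proof.
apply: (@iAST_simulation _ _ _ _ _
  (fun t t' => flat t = flat t' /\ pos_ann t `<=` pos_ann t') (fun=> 0%N)).
  by move=> t; split.
move=> c t mu t' [eF sub] /adp_stepP
  [_ [s [p [u [[[A PA <-] hs] [dp tp] [fu +] cE ->]]]]].
rewrite anf_usable_terms /= -map_comp /= in cE fu * => hanf.
have [u' tp' fu'] := subterm_at_eq_flat eF tp.
set c' := step_case_of `[< pos_ann t' p >] (flag A).
apply: (simulates_map (c' := c')
  (g := fun x => step_result c' t' p s x.2)).
- apply/adp_stepP; exists A, s, p, u'; split=> //; last by rewrite -fu'.
  by split=> //; exact: pos_def_ann_eq_flat dp.
- move=> x xA; split; first by rewrite !flat_step_result // flat_flat_usable eF.
  move=> q; rewrite cE !(pos_ann_step_result _ _ _ _ hs tp)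
    (pos_ann_step_result _ _ _ _ hs tp').
  case=> [[q' [/asboolP hp qE]]|[h1 h2 h3]]; last by right; split=> //; exact: sub.
  rewrite pos_ann_flat_usable => -[h _]; left; exists q'; split=> //.
  by apply/asboolP; exact: sub.
- rewrite cE !is_pcase_of; case: asboolP => hp'; [by left|right=> x _; split=> //].
  by move/asboolP/sub.
Qed.

(** [l] and [s] record the step that introduced the annotation, [u0] the non-usable subterm that
    carried it, and [w] what its instance has since become. *)
Definition dead w := exists l u0 s, [/\ exists d a, u0 = App (Ann d) a,
  ~ usable P l u0, plain_subst s, anf P (subst s l)
  & innermost_steps (np P) (subst s (annotate_root u0)) w].

Lemma dead_step w w' : dead w -> innermost_step (np P) w w' -> dead w'.
Proof.
move=> [l [u0 [s [h1 h2 h3 h4 h5]]]] st; exists l, u0, s; split=> //.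
by apply: rt_trans h5 _; exact: rt_step.
Qed.

(** If [x] had an annotation, [A] would witness that [u0] is usable after all. *)
Lemma dead_lhs_no_ann A s x q : P A -> plain_subst s -> anf P (subst s (lhs A)) ->
  dead (subst s (annotate_root (lhs A))) -> x \in rhs A -> ~ pos_ann x.2 q.
Proof.
move=> PA hs hanf [l [u0 [s1 [h1 h2 h3 h4 h5]]]] xA hq; apply: h2; split=> //.
by exists s1, s, A; split=> //; exists x => //; exists q.
Qed.

Lemma innermost_np A s x w p : P A -> flag A -> anf P (subst s (lhs A)) ->
  x \in rhs A -> subterm_at w p = Some (subst s (lhs A)) ->
  innermost_step (np P) w (replace_at w p (subst s (flat x.2))).
Proof.
move=> PA fA hanf xA wp; exists (lhs A), (flat x.2), s, p; split=> //.
  by exists A, x.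
move=> q w' qn qw p' l r s' [B [y [PB _ _ [-> _]]]] e.
(* A match for [np P] may use an annotated substitution, whereas [nf] asks for a plain one;
   flattening [s'] provides it. *)
apply: (hanf _ _ qn qw); exists p', B, (@flat S V \o s'); split=> //.
  by move=> z; exact: plain_flat.
rewrite subterm_at_flat e /= flat_subst (@flat_plain _ _ (lhs B)) //.
by case: (hP.2 _ PB).
Qed.

Definition ann_count t := #|` fset_set (pos_ann t)|.

Lemma ann_count_le t u : pos_ann t `<=` pos_ann u -> (ann_count t <= ann_count u)%N.
Proof.
move=> sub; apply: fsubset_leq_card; rewrite -fset_set_sub //; exact: finite_pos_ann.
Qed.

Lemma ann_count_lt t u p : pos_ann t `<=` pos_ann u -> pos_ann u p ->
  ~ pos_ann t p -> (ann_count t < ann_count u)%N.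
Proof.
move=> sub up ntp; apply: fproper_ltn_card; rewrite fproperE; apply/andP; split.
  by rewrite -fset_set_sub //; exact: finite_pos_ann.
apply/negP; rewrite -fset_set_sub; [by move=> /(_ _ up)| |]; exact: finite_pos_ann.
Qed.

(** Usability is tested with the root as the only annotation, hence [annotate_root w] instead of
    [w]. *)
Definition only_dead_dropped t t' := [/\ flat t = flat t', pos_ann t' `<=` pos_ann t
  & forall q w, pos_ann t q -> ~ pos_ann t' q -> subterm_at t q = Some w ->
      dead (annotate_root w)].

Lemma usable_terms_sound : iAST (usable_terms P) -> iAST P.
Proof.
apply: (@iAST_simulation _ _ _ _ _ only_dead_dropped ann_count).
  by move=> t; split.
move=> c t mu t' [eF sub ded] /adp_stepP
  [A [s [p [u [[PA hs] [dp tp] [fu hanf] cE ->]]]]].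
have [u' tp' fu'] := subterm_at_eq_flat eF tp.
set m := flag A in cE.
set c' := step_case_of `[< pos_ann t' p >] m.
have [d0 [a0 lE]] : exists d a, lhs A = App (Def d) a by case: (hP.2 _ PA).
(* An annotation dropped at the redex is dead, and its term is the annotated instance of [lhs A]. *)
have noann : pos_ann t p -> ~ pos_ann t' p ->
    forall x q, x \in rhs A -> ~ pos_ann x.2 q.
  move=> hp hp' x q; apply: (dead_lhs_no_ann PA hs hanf).
  rewrite -annotate_root_subst //; last by eexists; eexists; exact: lE.
  by rewrite -fu /annotate_root annotate_flat; exact: ded tp.
apply: (simulates_map (c' := c')
  (g := fun x => step_result c' t' p s (flat_usable P (lhs A) x.2))).
- apply/adp_stepP; exists (usable_adp P A), s, p, u'; split=> //=.
  + by split=> //; exists A.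
  + by split=> //; exact: pos_def_ann_eq_flat dp.
  + by rewrite -fu' anf_usable_terms.
  + by rewrite -map_comp.
- move=> x xA; set r := x.2.
  have posE q : pos_ann (step_result c t p s r) q <-> _ :=
    eq_rect_r (fun c => pos_ann (step_result c t p s r) q <-> _)
      (pos_ann_step_result _ _ _ _ hs tp) cE.
  have posE' q : pos_ann (step_result c' t' p s (flat_usable P (lhs A) r)) q <-> _ :=
    pos_ann_step_result _ _ _ _ hs tp'.
  split; first by rewrite !flat_step_result // flat_flat_usable eF.
    move=> q; rewrite posE posE'.
    case=> [[q' [/asboolP hp qE]]|[h1 h2 h3]]; last by right; split=> //; exact: sub.
    rewrite pos_ann_flat_usable => -[h _]; left; exists q'; split=> //.
    by apply/asboolP; exact: sub.
  move=> q w hq nq qw; rewrite /annotate_root -annotate_flat.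
  have : subterm_at (flat (step_result c t p s r)) q = Some (flat w).
    by rewrite subterm_at_flat qw.
  rewrite flat_step_result // => {}qw.
  have ftp : subterm_at (flat t) p = Some (flat u) by rewrite subterm_at_flat tp.
  case/posE: hq => [[q' [/asboolP hp qE hr]]|[npq hq keep]].
    (* The annotation is new. Since [t'] is annotated at [p], only [flat_usable] can have dropped
       it, so [u0] is not usable and zero [np P] steps show it dead. *)
    have [hp'|/(noann hp)/(_ x q' xA)//] := pselect (pos_ann t' p).
    have /pos_annP [d [a ru]] := hr; set u0 := App (Ann d) a in ru.
    have ruf : subterm_at (subst s (flat r)) q' = Some (subst s (flat u0)).
      by apply: subterm_at_subst; rewrite subterm_at_flat ru.
    move: qw; rewrite qE (subterm_at_replace_cat _ _ ftp) ruf => -[<-].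
    rewrite -/(annotate_root _) annotate_root_subst //; last first.
      by exists (Def d); rewrite /flat /u0 /= in_set0; eexists.
    rewrite /annotate_root annotate_flat.
    exists (lhs A), u0, s; split=> //; [by exists d, a| |exact: rt_refl].
    move=> us; apply: nq; apply/posE'; left; exists q'; split=> //.
      exact/asboolP.
    by apply/pos_ann_flat_usable; split=> //; exists u0.
  (* The annotation is inherited; had [t'] carried it, the simulating step would have kept it
     too. *)
  have nq' : ~ pos_ann t' q.
    by move=> h; apply: nq; apply/posE'; right.
  have /pos_annP [d [a tq]] := hq; set w0 := App (Ann d) a in tq.
  have dw0 := ded _ _ hq nq' tq.
  have ftq : subterm_at (flat t) q = Some (flat w0) by rewrite subterm_at_flat tq.
  have [pqp|nqp] := boolP (prefix q p); last first.
    move: qw; rewrite subterm_at_replace_parallel // ftq => -[<-].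
    by rewrite annotate_flat.
  (* Now [q] is strictly above [p]: the annotation survives only with flag [true], and then the dead
     term itself makes an [np P] step. *)
  have fA : flag A by exact: keep.
  have /prefixP [p' pE] := pqp; rewrite {}pE in npq ftp qw.
  case: p' npq ftp qw => [|i p'] npq ftp qw; first by rewrite cats0 prefix_refl in npq.
  move: qw; rewrite subterm_at_replace_above ftq => -[<-].
  rewrite annotate_replace annotate_flat.
  (* Below the root, [annotate_root] acts as [flat]; the path from [q] to the redex is nonempty. *)
  have e0 v : annotate [set q0 | [set [::]] ((i :: p') ++ q0)] v = flat v.
    exact: eq_annotate.
  rewrite e0 flat_plain_subst // flat_annotate.
  apply: dead_step dw0 (innermost_np PA fA hanf xA _).
  move: ftp; rewrite subterm_at_cat ftq /= -/(subterm_at _ (i :: p')) => ftp.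
  rewrite /annotate_root subterm_at_annotate.
  move: ftp; rewrite subterm_at_flat -fu.
  by case: subterm_at => [v|//] /= [<-]; congr Some; exact: e0.
- rewrite !is_pcase_of; have [hp'|hp'] := asboolP; [by left|right=> x xA].
  (* Without an annotation at [p] in [t'], the step adds none to [t]: either it is an R-step, or
     [noann] applies. *)
  have subx : pos_ann (step_result c t p s x.2) `<=` [set q | pos_ann t q /\ q <> p].
    move=> q; rewrite cE (pos_ann_step_result _ _ _ _ hs tp).
    case=> [[q' [/asboolP hp _ /(noann hp hp' _ _ xA)//]]|[npq h _]].
    by split=> // e; rewrite e prefix_refl in npq.
  split; first by apply: ann_count_le => q /subx [].
  rewrite cE is_pcase_of -cE => /asboolP hp; apply: (@ann_count_lt _ _ p) => //.
    by move=> q /subx [].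
  by move=> /subx [].
Qed.

End UsableTerms.

Theorem theorem16 (R : realType) (S : signature) (V : Type)
    (P : set (adp R S V)) (hP : adp_problem P) :
  iAST P <-> iAST (usable_terms P).
Proof.
split; [exact: usable_terms_complete|exact: usable_terms_sound].
Qed.
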